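(* A compact graph-like space is connected if and only if it is pseudo-arc connected.
   Context: Graph-like space: a topological space $G$ with vertex set $V(G)$, edge set $E(G)$, underlying set $V(G)\sqcup((0,1)\times E(G))$, and for each $e\in E(G)$ a continuous $\iota_e:[0,1]\to G$ with $\iota_e(x)=(x,e)$ for $x\in(0,1)$, $\iota_e(0),\iota_e(1)\in V(G)$, $\iota_e|_{(0,1)}$ an open map, and such that for any two distinct vertices $v,v'$ there are disjoint open $U\ni v$, $U'\ni v'$ partitioning $V(G)$. A sub-graph-like space has vertex and edge subsets and the subspace topology. $P-e$ denotes the subspace with the inner points $(0,1)\times\{e\}$ removed. A pseudo-arc is a compact connected graph-like space $P$ with a start-vertex $a$ and an end-vertex $b$ such that for every $e\in E(P)$, $a$ and $b$ are separated in $P-e$. $G$ is pseudo-arc connected if for any vertices $a,b$ there is a pseudo-arc $P\subseteq G$ (sub-graph-like space) with start-vertex $a$ and end-vertex $b$. *)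

(* Defs.v *)
From HB Require Import structures.
From mathcomp Require Import all_boot all_order all_algebra.
From mathcomp Require Import all_classical all_reals all_analysis.
Set Implicit Arguments.
Unset Strict Implicit.
Unset Printing Implicit Defensive.
Import Order.TTheory GRing.Theory Num.Theory.
Import numFieldNormedType.Exports.
Local Open Scope classical_set_scope.
Local Open Scope ring_scope.

Definition gl_point (R : realType) (V E : Type) : Type :=
  (V + {x : R | 0 < x < 1} * E)%type.

HB.instance Definition _ (R : realType) (V E : choiceType) :=
  Choice.copy (gl_point R V E) (V + {x : R | 0 < x < 1} * E)%type.

(* The map iota_e : [0,1] -> G is determined by its two end-vertices
   iota_e(0) = s e and iota_e(1) = t e, so these are the data carried by a
   graph-like space.  It is extended to R by constants; only its restriction to
   [0,1] is ever used. *)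
Definition edge_map (R : realType) (V E : Type) (s t : E -> V) (e : E) (x : R) :
    gl_point R V E :=
  if insub x is Some y then inr (y, e) else inl (if x <= 0 then s e else t e).

Lemma edge_map_in (R : realType) (V E : Type) (s t : E -> V) (e : E)
  (x : {x : R | 0 < x < 1}) : edge_map s t e (val x) = inr (x, e).
Proof. by rewrite /edge_map valK. Qed.

Lemma edge_map0 (R : realType) (V E : Type) (s t : E -> V) (e : E) :
  edge_map s t e (0 : R) = inl (s e).
Proof. by rewrite /edge_map insubF ?ltxx// lexx. Qed.

Lemma edge_map1 (R : realType) (V E : Type) (s t : E -> V) (e : E) :
  edge_map s t e (1 : R) = inl (t e).
Proof. by rewrite /edge_map insubF ?ltxx ?andbF// ler10. Qed.

(* [gl_class] is a topology on the literal underlying set V + (0,1) * E.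
   Neither Hausdorffness nor non-emptiness is required, and loops and parallel
   edges are allowed. *)
Record graphLike (R : realType) := GraphLike {
  gl_vertex : choiceType;
  gl_edge : choiceType;
  gl_class : Topological (gl_point R gl_vertex gl_edge);
  gl_space : topologicalType := Topological.Pack gl_class;
  gl_src : gl_edge -> gl_vertex;
  gl_tgt : gl_edge -> gl_vertex;
  gl_iota_continuous : forall e : gl_edge,
    {within `[0, 1], continuous (edge_map gl_src gl_tgt e : R -> gl_space)};
  gl_iota_open : forall (e : gl_edge) (U : set R),
    open U -> U `<=` `]0, 1[ ->
    open (edge_map gl_src gl_tgt e @` U : set gl_space);
  gl_separation : forall v v' : gl_vertex, v <> v' ->
    exists U U' : set gl_space,
      [/\ open U, open U', U `&` U' = set0, U (inl v) /\ U' (inl v')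
        & range inl `<=` U `|` U'] }.

Coercion gl_space : graphLike >-> Topological.type.

Definition gl_iota (R : realType) (G : graphLike R) (e : gl_edge G) : R -> G :=
  edge_map (@gl_src R G) (@gl_tgt R G) e.

Definition gl_pt (R : realType) (G : graphLike R) (v : gl_vertex G) : G := inl v.

Definition gl_inner (R : realType) (G : graphLike R) (e : gl_edge G) : set G :=
  [set inr (x, e) | x in [set: {x : R | 0 < x < 1}]].

Record subGraphLike (R : realType) (G : graphLike R) := SubGraphLike {
  sub_vertex : set (gl_vertex G);
  sub_edge : set (gl_edge G);
  sub_src : forall e, sub_edge e -> sub_vertex (gl_src e);
  sub_tgt : forall e, sub_edge e -> sub_vertex (gl_tgt e) }.

Section sub_graph_like.
Variables (R : realType) (G : graphLike R) (H : subGraphLike G).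
Let VH : choiceType := set_type (sub_vertex H).
Let EH : choiceType := set_type (sub_edge H).

Definition sub_incl (p : gl_point R VH EH) : G :=
  match p with inl v => inl (val v) | inr (x, e) => inr (x, val e) end.

Let s (e : EH) : VH := SigSub (mem_set (sub_src (set_mem (valP e)))).
Let t (e : EH) : VH := SigSub (mem_set (sub_tgt (set_mem (valP e)))).

Let sub_incl_edge_map (e : EH) (x : R) :
  sub_incl (edge_map s t e x) = gl_iota (val e) x.
Proof.
by rewrite /gl_iota /edge_map; case: insubP => [y _ _|_] //=; case: ifP.
Qed.

Let sub_incl_inj : injective sub_incl.
Proof.
by case=> [v|[x e]] [v'|[x' e']] //= [] => [/val_inj ->|-> /val_inj ->].
Qed.

(* the subspace topology inherited from G *)
Let sub_space : topologicalType := initial_topology sub_incl.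

Let sub_iota_continuous (e : EH) :
  {within `[0, 1], continuous (edge_map s t e : R -> sub_space)}.
Proof.
apply/(@continuous_comp_initial _ _ _ sub_incl).
have -> : sub_incl \o edge_map s t e = gl_iota (val e).
  by apply/funext => x /=; rewrite sub_incl_edge_map.
exact: gl_iota_continuous.
Qed.

Let sub_iota_open (e : EH) (U : set R) : open U -> U `<=` `]0, 1[ ->
  open (edge_map s t e @` U : set sub_space).
Proof.
move=> oU U01; exists (gl_iota (val e) @` U); first exact: gl_iota_open.
apply/seteqP; split=> [p [x Ux px]|_ [x Ux <-]] /=; exists x => //.
by apply: sub_incl_inj; rewrite sub_incl_edge_map.
Qed.

Let sub_separation (v v' : VH) : v <> v' ->
  exists U U' : set sub_space,
    [/\ open U, open U', U `&` U' = set0, U (inl v) /\ U' (inl v')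
      & range inl `<=` U `|` U'].
Proof.
move=> vv'; have /gl_separation[U [U' [oU oU' UU' [Uv Uv'] VU]]] :
  val v <> val v' by move/val_inj.
exists (sub_incl @^-1` U), (sub_incl @^-1` U'); split=> //.
- by exists U.
- by exists U'.
- by rewrite -preimage_setI UU' preimage_set0.
- by move=> _ [w _ <-]; apply: VU; exists (val w).
Qed.

Definition sub_graphLike : graphLike R :=
  @GraphLike R VH EH (Topological.class sub_space) s t
    sub_iota_continuous sub_iota_open sub_separation.

End sub_graph_like.

(* [separated A B] is taken in T; this agrees with being separated in the
   subspace S, since A and B are subsets of S. *)
Definition separated_in (T : topologicalType) (S : set T) (x y : T) : Prop :=
  exists A B : set T, [/\ A `|` B = S, separated A B, A x & B y].

Definition pseudo_arc (R : realType) (P : graphLike R) (a b : gl_vertex P) :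
    Prop :=
  [/\ compact [set: P], connected [set: P] &
    forall e : gl_edge P,
      separated_in (~` gl_inner e) (gl_pt a) (gl_pt b)].

Definition pseudo_arc_connected (R : realType) (G : graphLike R) : Prop :=
  forall a b : gl_vertex G,
    exists (H : subGraphLike G) (a' b' : gl_vertex (sub_graphLike H)),
      [/\ val a' = a, val b' = b & pseudo_arc a' b'].

(* Main.v *)
Require Import Defs.
From HB Require Import structures.
From mathcomp Require Import all_boot all_order all_algebra.
From mathcomp Require Import all_classical all_reals all_analysis.
Set Implicit Arguments.
Unset Strict Implicit.
Unset Printing Implicit Defensive.
Import Order.TTheory GRing.Theory Num.Theory.
Import numFieldNormedType.Exports.
Local Open Scope classical_set_scope.

(** If [G] is connected, Zorn's lemma gives a minimal closed, edge-saturated set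
    [K] containing [a] and [b] in which [a] and [b] are not separated.
    Minimality makes [K] connected (a clopen piece of [K] containing [a] and [b]
    is again such a set) and makes [a] and [b] separated in [K - e] for each of
    its edges [e], so [K] is a pseudo-arc.  Conversely each part of a
    disconnection of [G] contains a vertex, since edges are connected, and no
    connected subspace joins those two vertices.

    [G] need not be Hausdorff, so that a decreasing intersection of sets in
    which [a] and [b] are not separated has this property is not an instance of
    the usual theorem on compact spaces.  It holds because disjoint closed
    edge-saturated sets [A] and [B] have disjoint open neighbourhoods covering
    all vertices: compactness globalises the separation of pairs of vertices,
    and inner edges are open.  If [A] and [B] split the intersection of a chain,
    the complement of these neighbourhoods is compact and covered by inner
    edges, so some member of the chain already avoids it. *)

(** * Compactness, separated sets and initial topologies *)

Lemma compact_open_ind (T : topologicalType) (K : set T) (Q : set T -> Prop) :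
  compact K -> Q set0 ->
  (forall U W, open U -> open W -> Q U -> Q W -> Q (U `|` W)) ->
  (forall x, K x -> exists U, [/\ open U, U x & Q U]) ->
  exists U, [/\ open U, K `<=` U & Q U].
Proof.
move=> cptK Q0 QU Kloc; apply: contrapT => nU.
(* Otherwise the complements in [K] of the open sets satisfying [Q] generate a proper filter, and a
   cluster point of it in [K] has no open neighbourhood satisfying [Q]. *)
pose F := filter_from [set U | open U /\ Q U] (fun U => K `\` U).
have FF : ProperFilter F.
  apply: filter_from_proper.
    apply: filter_from_filter; first by exists set0; split=> //; exact: open0.
    move=> U W [oU QU'] [oW QW]; exists (U `|` W).
      by split; [exact: openU|exact: QU].
    by rewrite setDUr.
  move=> U [oU QU']; apply/set0P/negP => /eqP; rewrite setD_eq0 => KU.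
  by apply: nU; exists U.
have [|p [Kp clp]] := cptK F FF.
  by exists set0; [split=> //; exact: open0|rewrite setD0].
have [U [oU Up QU']] := Kloc _ Kp.
have FU : F (K `\` U) by exists U.
by have [q [[]]] := clp _ _ FU (open_nbhs_nbhs (conj oU Up)).
Qed.

Lemma closed_separated (T : topologicalType) (A B : set T) :
  closed A -> closed B -> A `&` B = set0 -> separated A B.
Proof. by move=> /closure_id cA /closure_id cB AB; split; rewrite -?cA -?cB. Qed.

Lemma separated_closedl (T : topologicalType) (K A B : set T) :
  closed K -> A `|` B = K -> separated A B -> closed A.
Proof.
move=> cK ABK [clAB _] x clAx.
have : K x by apply: cK; apply: closureS clAx; rewrite -ABK; exact: subsetUl.
rewrite -ABK => -[//|Bx].
by have : (closure A `&` B) x by []; rewrite clAB.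
Qed.

Lemma separated_closedr (T : topologicalType) (K A B : set T) :
  closed K -> A `|` B = K -> separated A B -> closed B.
Proof. by rewrite setUC separatedC; exact: separated_closedl. Qed.

Lemma compact_initial (S : choiceType) (T : topologicalType) (f : S -> T) :
  compact (range f) -> compact [set: initial_topology f].
Proof.
move=> cptf F FF _.
have [|_ [[x _ <-] clx]] := cptf (f @ F) (fmap_proper_filter f FF).
  by rewrite /fmap/=; apply: filterS (@filterT _ F _) => x _; exists x.
exists x; split=> // A B FA [_ [[U oU <-] Ux UB]].
have fA : (f @ F) (f @` A) by rewrite /fmap/=; apply: filterS FA => y Ay; exists y.
have [_ [[y Ay <-] Uy]] := clx _ _ fA (open_nbhs_nbhs (conj oU Ux)).
by exists y; split=> //; exact: UB.
Qed.

(** A clopen set [B] is the preimage both of an open set [U] and of the complement of an open set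
    [W], so its image is clopen in the range of [f]. *)
Lemma connected_initial (S : choiceType) (T : topologicalType) (f : S -> T) :
  connected (range f) -> connected [set: initial_topology f].
Proof.
move=> cf B [x0 Bx0] [C oC BC] [Z cZ BZ].
rewrite setTI in BC; rewrite setTI in BZ; subst C.
have [U oU fUB] := oC.
have [W oW fWB] : open (~` B : set (initial_topology f)).
  by rewrite openC BZ.
have BU y : B y <-> U (f y) by rewrite -fUB.
have BW y : B y <-> ~ W (f y).
  have -> : W (f y) = (~` B) y by rewrite -fWB.
  by split=> [By|/contrapT].
have fB : f @` B = range f.
  apply: cf; first by exists (f x0); exists x0.
  - exists U => //; apply/seteqP; split=> [_ [y By <-]|_ [[y _ <-] Uy]].
      by split; [exists y|apply/BU].
    by exists y => //; apply/BU.
  - exists (~` W); first exact: open_closedC.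
    apply/seteqP; split=> [_ [y By <-]|_ [[y _ <-] Wy]].
      by split; [exists y|apply/BW].
    by exists y => //; apply/BW.
apply/seteqP; split=> // x _.
have [y By yx] : (f @` B) (f x) by rewrite fB; exists x.
by apply/BU; rewrite -yx; apply/BU.
Qed.

(** * Open bipartitions of a set *)

Section open_bipartition.
Variables (T : topologicalType) (Z : set T).

(** With [Z] the set of vertices this is the form of the axiom [gl_separation]; points outside [Z]
    may escape both sides. *)
Definition open_bipartition (U W : set T) :=
  [/\ open U, open W, U `&` W = set0 & Z `<=` U `|` W].

Lemma open_bipartitionC U W : open_bipartition U W -> open_bipartition W U.
Proof. by case=> oU oW UW ZUW; split=> //; rewrite 1?setIC 1?setUC. Qed.

(** Finitely many bipartitions combine by uniting the sides that cover [X] and intersecting the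
    sides that contain [Y]: a point of [Z] in neither [U1] nor [U2] lies in both [W1] and [W2]. *)
Lemma compact_bipartitionl (X Y : set T) : compact X ->
  (forall x, X x -> exists U W, [/\ open_bipartition U W, U x & Y `<=` W]) ->
  exists U W, [/\ open_bipartition U W, X `<=` U & Y `<=` W].
Proof.
move=> cptX Xloc.
pose Q U := exists2 W, open_bipartition U W & Y `<=` W.
have [] := @compact_open_ind T X Q cptX.
- exists setT => //; split; [exact: open0|exact: openT|exact: set0I|].
  by rewrite setUT.
- move=> U1 U2 oU1 oU2 [W1 [_ oW1 UW1 Z1] YW1] [W2 [_ oW2 UW2 Z2] YW2].
  exists (W1 `&` W2); last by move=> y Yy; split; [exact: YW1|exact: YW2].
  split; [exact: openU|exact: openI| |].
  + apply/seteqP; split=> // y [[Uy|Uy] [W1y W2y]].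
      by rewrite -UW1.
    by rewrite -UW2.
  + move=> y Zy; case: (Z1 _ Zy) (Z2 _ Zy) => [?|?] [?|?];
      by [left; left|left; right|right].
- move=> x /Xloc[U [W [bUW Ux YW]]]; exists U; split=> //; last by exists W.
  by case: bUW.
- by move=> U [oU XU [W bUW YW]]; exists U, W.
Qed.

(** The one-sided lemma is used twice: over [Y] against a single point [x], then over [X] against
    [Y]. *)
Lemma compact_bipartition (X Y : set T) : compact X -> compact Y ->
  (forall x y, X x -> Y y ->
    exists U W, [/\ open_bipartition U W, U x & W y]) ->
  exists U W, [/\ open_bipartition U W, X `<=` U & Y `<=` W].
Proof.
move=> cptX cptY XYloc; apply: compact_bipartitionl => // x Xx.
have [y Yy|W [U [bWU YW xU]]] := @compact_bipartitionl Y [set x] cptY.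
  have [U [W [bUW Ux Wy]]] := XYloc _ _ Xx Yy.
  by exists W, U; split=> //; [exact: open_bipartitionC|move=> _ ->].
by exists U, W; split=> //; [exact: open_bipartitionC|exact: xU].
Qed.

End open_bipartition.

(** * Edges and edge-saturated sets in a graph-like space *)

Section graph_like.
Variables (R : realType) (G : graphLike R).
Implicit Types (e : gl_edge G) (v : gl_vertex G) (K A B : set G).

Lemma gl_inner_open e : open (gl_inner e).
Proof.
have -> : gl_inner e = gl_iota e @` `]0%R, 1%R[.
  apply/seteqP; split=> [_ [x _ <-]|_ [x x01 <-]].
    by exists (val x); [rewrite /= in_itv/= (valP x)|exact: edge_map_in].
  rewrite /= in_itv/= in x01.
  by exists (Sub x x01) => //; rewrite -(edge_map_in (@gl_src R G) (@gl_tgt R G)).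
apply: gl_iota_open => //; exact: interval_open.
Qed.

Lemma gl_iota_connected e : connected (gl_iota e @` `[0%R, 1%R]).
Proof.
apply: connected_continuous_connected; first exact: segment_connected.
exact: gl_iota_continuous.
Qed.

Lemma sub_gl_inner e : gl_inner e `<=` gl_iota e @` `[0%R, 1%R].
Proof.
move=> _ [x _ <-]; exists (val x); last exact: edge_map_in.
by rewrite /= in_itv/=; have /andP[/ltW-> /ltW->] := valP x.
Qed.

Lemma gl_inner_neq0 e : gl_inner e !=set0.
Proof.
have half01 : (0 < (2^-1 : R) < 1)%R by rewrite invr_gt0 ltr0n/= invf_lt1 ?ltr1n.
by exists (inr (Sub 2^-1%R half01, e)), (Sub 2^-1%R half01).
Qed.

Lemma gl_iota_src e : (gl_iota e @` `[0%R, 1%R]) (gl_pt (gl_src e)).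
Proof. by exists 0%R; [rewrite /= in_itv/= lexx ler01|exact: edge_map0]. Qed.

Lemma gl_iota_tgt e : (gl_iota e @` `[0%R, 1%R]) (gl_pt (gl_tgt e)).
Proof. by exists 1%R; [rewrite /= in_itv/= lexx ler01|exact: edge_map1]. Qed.

Lemma gl_iotaE e : gl_iota e @` `[0%R, 1%R] =
  gl_inner e `|` [set gl_pt (gl_src e); gl_pt (gl_tgt e)].
Proof.
apply/seteqP; split=> [_ [x _ <-]|p].
  rewrite /gl_iota /edge_map; case: insubP => [y _ _|_]; first by left; exists y.
  by right; case: ifP; [left|right].
by move=> [/sub_gl_inner|[->|->]] //; [exact: gl_iota_src|exact: gl_iota_tgt].
Qed.

(** These are exactly the underlying sets of sub-graph-like spaces: an inner point brings along its
    closed edge, end-vertices included. *)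
Definition edge_saturated K :=
  forall e p, K p -> gl_inner e p -> gl_iota e @` `[0%R, 1%R] `<=` K.

(** A closed edge is connected, so it lies on one side of the separation. *)
Lemma edge_saturated_splitl K A B :
  edge_saturated K -> A `|` B = K -> separated A B -> edge_saturated A.
Proof.
move=> satK ABK sAB e p Ap ep.
have Kp : K p by rewrite -ABK; left.
have := satK e p Kp ep; rewrite -{1}ABK => eAB.
have [//|eB] := connected_subset sAB eAB (gl_iota_connected (e:=e)).
have : (A `&` B) p by split=> //; apply: eB; exact: sub_gl_inner.
by rewrite (separated_disjoint sAB).
Qed.

Lemma edge_saturated_splitr K A B :
  edge_saturated K -> A `|` B = K -> separated A B -> edge_saturated B.
Proof. by rewrite setUC separatedC; exact: edge_saturated_splitl. Qed.

Definition vertices : set G := range (@gl_pt R G).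

Lemma vertices_closed : closed vertices.
Proof.
rewrite -[vertices]setCK; apply: open_closedC.
have -> : ~` vertices = \bigcup_e gl_inner e.
  apply/seteqP; split=> [[v|[x e]] nv|_ [e _ [x _ <-]]].
  - by exfalso; apply: nv; exists v.
  - by exists e => //; exists x.
  - by case.
by apply: bigcup_open => e _; exact: gl_inner_open.
Qed.

(* Away from the vertices, [A] is a union of open inner edges. *)
Lemma edge_saturated_openU A (O : set G) : edge_saturated A -> open O ->
  A `&` vertices `<=` O -> open (O `|` A).
Proof.
move=> satA oO AvO.
have -> : O `|` A = O `|` \bigcup_(e in [set e | gl_inner e `<=` A]) gl_inner e.
  apply/seteqP; split=> p [Op|]; try by left.
    case: p => [v|[x e]] Ap; first by left; apply: AvO; split=> //; exists v.
    right; exists e; last by exists x.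
    apply: subset_trans (@sub_gl_inner e) _.
    by apply: satA Ap _; exists x.
  by move=> [e /= eA ep]; right; exact: eA.
by apply: openU => //; apply: bigcup_open => e _; exact: gl_inner_open.
Qed.

(** * Separation and chains under compactness *)

Hypothesis cptG : compact [set: G].

Lemma edge_saturated_bipartition A B : closed A -> closed B ->
  edge_saturated A -> edge_saturated B -> A `&` B = set0 ->
  exists U W, [/\ open_bipartition vertices U W, A `<=` U & B `<=` W].
Proof.
move=> cA cB satA satB AB.
have cptV K : closed K -> compact (K `&` vertices).
  move=> cK; apply: subclosed_compact cptG _ => //.
  exact: closedI cK vertices_closed.
have [] := @compact_bipartition G vertices _ _ (cptV _ cA) (cptV _ cB).
  move=> x y [Ax [v _ vx]] [By [w _ wy]]; subst x y.
  have vw : v <> w.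
    move=> vw; have : (A `&` B) (gl_pt v) by split=> //; rewrite vw.
    by rewrite AB.
  by have [U [W [oU oW UW [Uv Ww] VUW]]] := gl_separation vw; exists U, W.
move=> U [W [[oU oW UW VUW] AU BW]].
(* [U] and [W] are only known to contain the vertices of [A] and [B]. Adjoining the rest of [A] and
   [B] keeps them open by [edge_saturated_openU], and removing the opposite set first keeps them
   disjoint. *)
exists ((U `\` B) `|` A), ((W `\` A) `|` B); split; last 2 first.
- exact: subsetUr.
- exact: subsetUr.
have nAB p : A p -> B p -> False.
  by move=> Ap Bp; have : (A `&` B) p by []; rewrite AB.
split.
- apply: edge_saturated_openU => //; first by apply: openI => //; exact: closed_openC.
  by move=> p [Ap Vp]; split; [exact: AU|move=> Bp; exact: nAB Ap Bp].
- apply: edge_saturated_openU => //; first by apply: openI => //; exact: closed_openC.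
  by move=> p [Bp Vp]; split; [exact: BW|move=> Ap; exact: nAB Ap Bp].
- apply/seteqP; split=> // p [[[Up nBp]|Ap] [[Wp nAp]|Bp]] //.
    by rewrite -UW.
  exact: nAB Ap Bp.
- move=> p /VUW[Up|Wp].
    by have [Bp|nBp] := pselect (B p); [right; right|left; left].
  by have [Ap|nAp] := pselect (A p); [left; right|right; left].
Qed.

(** A saturated set missing one inner point of an edge misses them all, and these form an open set;
    so each point outside [U] has a neighbourhood avoided by some member of [F]. As [F] is a chain,
    one member avoids finitely many of these. *)
Lemma edge_saturated_chain_sub (F : set (set G)) (U : set G) :
  F !=set0 -> total_on F subset -> (forall K, F K -> edge_saturated K) ->
  open U -> vertices `<=` U -> \bigcap_(K in F) K `<=` U ->
  exists2 K, F K & K `<=` U.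
Proof.
move=> [K0 FK0] totF satF oU VU FU.
pose Q N := exists2 K, F K & K `&` N = set0.
have [] := @compact_open_ind G (~` U) Q.
- by apply: subclosed_compact cptG _ => //; exact: open_closedC.
- by exists K0 => //; exact: setI0.
- move=> N1 N2 _ _ [K1 FK1 KN1] [K2 FK2 KN2].
  have [K12|K21] := totF _ _ FK1 FK2.
    exists K1 => //; apply/seteqP; split=> // p [K1p [N1p|N2p]].
      by rewrite -KN1.
    by rewrite -KN2; split=> //; exact: K12.
  exists K2 => //; apply/seteqP; split=> // p [K2p [N1p|N2p]].
    by rewrite -KN1; split=> //; exact: K21.
  by rewrite -KN2.
- move=> [v|[x e]] nU; first by exfalso; apply/nU/VU; exists v.
  exists (gl_inner e); split; [exact: gl_inner_open|by exists x|].
  apply: contrapT => nQ; apply/nU/FU => K FK; apply: contrapT => nKx.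
  apply: nQ; exists K => //; apply/seteqP; split=> // p [Kp ep]; apply: nKx.
  by apply: (satF _ FK _ _ Kp ep); apply: sub_gl_inner; exists x.
- move=> N [_ UN [K FK KN]]; exists K => // p Kp.
  by apply: contrapT => /UN Np; have : (K `&` N) p by []; rewrite KN.
Qed.

(** * Minimal sets in which two vertices are inseparable *)

Section inseparable.
Variables a b : gl_vertex G.

(** Non-separation of [a] from [b] stands in for connectedness: it passes to intersections of
    chains, and minimality recovers connectedness. *)
Definition inseparable_subgraph K :=
  [/\ closed K, edge_saturated K, K (gl_pt a), K (gl_pt b) &
    ~ separated_in K (gl_pt a) (gl_pt b)].

Lemma inseparable_bigcap (F : set (set G)) : F !=set0 -> total_on F subset ->
  F `<=` inseparable_subgraph -> inseparable_subgraph (\bigcap_(K in F) K).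
Proof.
move=> F0 totF insF; have cC : closed (\bigcap_(K in F) K).
  by apply: closed_bigI => K /insF[].
have satC : edge_saturated (\bigcap_(K in F) K).
  move=> e p Cp ep q eq K FK; have [_ satK _ _ _] := insF _ FK.
  by apply: satK (Cp _ FK) ep _ eq.
split=> //; try by move=> K /insF[].
move=> [A [B [ABC sAB Aa Bb]]].
have [U [W [[oU oW UW VUW] AU BW]]] := edge_saturated_bipartition
  (separated_closedl cC ABC sAB) (separated_closedr cC ABC sAB)
  (edge_saturated_splitl satC ABC sAB) (edge_saturated_splitr satC ABC sAB)
  (separated_disjoint sAB).
have CUW : \bigcap_(K in F) K `<=` U `|` W by rewrite -ABC; exact: setUSS.
have [|K FK KUW] := edge_saturated_chain_sub F0 totF _ (openU oU oW) VUW CUW.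
  by move=> K /insF[].
have [cK satK Ka Kb] := insF _ FK; apply.
have nUW p : U p -> W p -> False.
  by move=> Up Wp; have : (U `&` W) p by []; rewrite UW.
(* Since [K] is covered by the disjoint open sets [U] and [W], removing either one leaves a closed
   piece, and the two pieces separate [a] from [b]. *)
exists (K `\` W), (K `\` U); split.
- apply/seteqP; split=> [p [[]|[]]//|p Kp].
  have [Up|Wp] := KUW _ Kp.
    by left; split=> // Wp; exact: nUW Up Wp.
  by right; split=> // Up; exact: nUW Up Wp.
- apply: closed_separated.
  + by apply: closedI => //; exact: open_closedC.
  + by apply: closedI => //; exact: open_closedC.
  + by apply/seteqP; split=> // p [[Kp nWp] [_ nUp]]; have [] := KUW _ Kp.
- by split=> // Wa; exact: nUW (AU _ Aa) Wa.
- by split=> // Ub; exact: nUW Ub (BW _ Bb).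
Qed.

Lemma inseparable_minimal : connected [set: G] ->
  exists2 K, inseparable_subgraph K &
    forall L, inseparable_subgraph L -> L `<=` K -> L = K.
Proof.
move=> conG.
have insT : inseparable_subgraph setT.
  split=> //.
  move=> [A [B [ABT sAB Aa Bb]]]; have := connected_subset sAB _ conG.
  rewrite ABT => -[//|TA|TB].
    have : (A `&` B) (gl_pt b) by split=> //; exact: TA.
    by rewrite (separated_disjoint sAB).
  have : (A `&` B) (gl_pt a) by split=> //; exact: TB.
  by rewrite (separated_disjoint sAB).
(* [Zorn_bigcup] yields maximal sets from unions of chains, so it is applied to complements; the
   empty chain is covered by [insT]. *)
have [|N [insN maxN]] := @Zorn_bigcup G [set N | inseparable_subgraph (~` N)].
  move=> F insF totF /=.
  have [->|F0] := eqVneq F set0; first by rewrite bigcup_set0 setC0.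
  rewrite setC_bigcup -(bigcap_image _ (@setC G) id).
  apply: inseparable_bigcap.
  - by move/set0P : F0 => [N FN]; exists (~` N); exists N.
  - move=> _ _ [N FN <-] [M FM <-].
    by have [NM|MN] := totF _ _ FN FM; [right|left]; exact: subsetC.
  - by move=> _ [N FN <-]; exact: insF.
exists (~` N) => // L insL LN; apply: contrapT => LnN.
apply: (maxN (~` L)); last by rewrite /= setCK.
split=> [p Np /LN//|LN']; apply: LnN; apply/seteqP; split=> // p Np.
by apply: contrapT => /LN'.
Qed.

(** If [A1] and [A2] separated [a] from [b] in [A], adjoining [B] to [A2] would separate them in
    [K]. *)
Lemma inseparable_splitl K A B : inseparable_subgraph K ->
  A `|` B = K -> separated A B -> A (gl_pt a) -> A (gl_pt b) ->
  inseparable_subgraph A.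
Proof.
move=> [cK satK _ _ nsepK] ABK sAB Aa Ab.
have cA := separated_closedl cK ABK sAB; have cB := separated_closedr cK ABK sAB.
split=> //; first exact: edge_saturated_splitl satK ABK sAB.
move=> [A1 [A2 [A12 sA Aa1 Ab2]]]; apply: nsepK.
exists A1, (A2 `|` B); split=> //; first by rewrite setUA A12.
  apply: closed_separated.
  - exact: separated_closedl cA A12 sA.
  - by apply: closedU => //; exact: separated_closedr cA A12 sA.
  - rewrite setIUr (separated_disjoint sA) set0U; apply/disjoints_subset.
    apply: (@subset_trans _ A); first by rewrite -A12; exact: subsetUl.
    exact/disjoints_subset/separated_disjoint.
by left.
Qed.

Lemma inseparable_minimal_connected K : inseparable_subgraph K ->
  (forall L, inseparable_subgraph L -> L `<=` K -> L = K) -> connected K.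
Proof.
move=> insK minK; apply/connectedP => E [E0 KE sE].
have [_ _ Ka Kb nsepK] := insK.
(* A side that contains [a] also contains [b], hence is all of [K] by minimality, leaving the other
   side empty. Applied to both sides, this leaves no place for [a]. *)
have noab A B : A !=set0 -> B !=set0 -> A `|` B = K -> separated A B ->
    ~ A (gl_pt a).
  move=> [x Ax] [y By] ABK sAB Aa.
  have Ab : A (gl_pt b).
    move: Kb; rewrite -ABK => -[//|Bb].
    by exfalso; apply: nsepK; exists A, B.
  have AK : A = K.
    apply: minK; first exact: inseparable_splitl insK ABK sAB Aa Ab.
    by rewrite -ABK; exact: subsetUl.
  have : (A `&` B) y by split=> //; rewrite AK -ABK; right.
  by rewrite (separated_disjoint sAB).
move: Ka; rewrite KE => -[].
  exact: noab (E0 false) (E0 true) (esym KE) sE.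
apply: (noab _ _ (E0 true) (E0 false)); last by rewrite separatedC.
by rewrite setUC KE.
Qed.

(** Otherwise removing the inner points of [e] would give a strictly smaller inseparable set: it
    stays closed because they form an open set, and saturated because no other closed edge contains
    them. *)
Lemma inseparable_minimal_edge K e : inseparable_subgraph K ->
  (forall L, inseparable_subgraph L -> L `<=` K -> L = K) ->
  gl_inner e `&` K !=set0 ->
  separated_in (K `\` gl_inner e) (gl_pt a) (gl_pt b).
Proof.
move=> [cK satK Ka Kb nsepK] minK [p [ep Kp]]; apply: contrapT => nsep.
have : K p by [].
rewrite -(minK (K `\` gl_inner e)); [by case| |exact: subDsetl].
split=> //; try by split=> // -[].
  by apply: closedI => //; apply: open_closedC; exact: gl_inner_open.
move=> f q [Kq neq] fq r fr; split; first exact: satK fq _ fr.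
move: fr; rewrite gl_iotaE => -[[y _ <-] [z _ [_ ef]]|[->|->] []//].
by apply: neq; rewrite ef.
Qed.

End inseparable.

(** * Saturated sets as sub-graph-like spaces *)

Section saturated_subgraph.
Variables (K : set G) (satK : edge_saturated K).

(** By saturation an edge belongs as soon as one of its inner points lies in [K], so no point of [K]
    is lost. *)
Definition saturated_subgraph : subGraphLike G :=
  @SubGraphLike R G [set v | K (gl_pt v)]
    [set e | gl_iota e @` `[0%R, 1%R] `<=` K]
    (fun e eK => eK _ (gl_iota_src e)) (fun e eK => eK _ (gl_iota_tgt e)).

Lemma range_sub_incl_saturated : range (@sub_incl R G saturated_subgraph) = K.
Proof.
apply/seteqP; split=> [_ [[v|[x e]] _ <-]/=|[v|[x e]] Kp].
- exact: set_mem (valP v).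
- by apply: (set_mem (valP e)); apply: sub_gl_inner; exists x.
- by exists (inl (SigSub (mem_set Kp : v \in sub_vertex saturated_subgraph))).
- have eK : sub_edge saturated_subgraph e by apply: satK Kp _; exists x.
  by exists (inr (x, SigSub (mem_set eK))).
Qed.

End saturated_subgraph.

Lemma sub_incl_inner (H : subGraphLike G) (e : gl_edge (sub_graphLike H)) :
  ~` gl_inner e = @sub_incl R G H @^-1` (~` gl_inner (val e)).
Proof.
apply/seteqP; split=> [p nep [x _ xp]|p nep [x _ xp]]; apply: nep.
  case: p xp => [//|[y f]] [_ /val_inj <-].
  by exists y.
by rewrite -xp /=; exists x.
Qed.

End graph_like.

(** * The two implications *)

Lemma connected_pseudo_arc_connected (R : realType) (G : graphLike R) :
  compact [set: G] -> connected [set: G] -> pseudo_arc_connected G.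
Proof.
move=> cptG conG a b.
have [K insK minK] := inseparable_minimal cptG a b conG.
have [cK satK Ka Kb nsepK] := insK.
pose H := saturated_subgraph K.
have HK : range (@sub_incl R G H) = K by exact: range_sub_incl_saturated.
exists H, (SigSub (mem_set Ka : a \in sub_vertex H)),
  (SigSub (mem_set Kb : b \in sub_vertex H)); split=> //; split.
- apply: compact_initial; rewrite HK.
  exact: subclosed_compact cptG _.
- apply: connected_initial; rewrite HK.
  exact: inseparable_minimal_connected minK.
- move=> e.
  have [|A [B [ABK sAB Aa Bb]]] :=
    @inseparable_minimal_edge _ _ a b K (val e) insK minK.
    have [x ex] := gl_inner_neq0 e.
    exists (sub_incl x); split; last by rewrite -HK; exists x.
    by case: ex => y _ <-; exists y.
  (* Both sides are closed in [G], so their preimages in the sub-graph-like space are closed and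
     disjoint, hence separated. *)
  have cKe : closed (K `\` gl_inner (val e)).
    by apply: closedI => //; apply: open_closedC; exact: gl_inner_open.
  have ci := @initial_continuous _ _ (@sub_incl R G H).
  exists (@sub_incl R G H @^-1` A), (@sub_incl R G H @^-1` B); split=> //.
    rewrite -preimage_setU ABK sub_incl_inner.
    apply/seteqP; split=> [p []//|p nep]; split=> //.
    by rewrite -HK; exists p.
  apply: closed_separated.
  + by apply: closed_comp (separated_closedl cKe ABK sAB) => p _; exact: ci.
  + by apply: closed_comp (separated_closedr cKe ABK sAB) => p _; exact: ci.
  + by rewrite -preimage_setI (separated_disjoint sAB) preimage_set0.
Qed.

Lemma pseudo_arc_connected_connected (R : realType) (G : graphLike R) :
  pseudo_arc_connected G -> connected [set: G].
Proof.
move=> paG; apply/connectedP => E [E0 TE sE].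
have satE c : edge_saturated (E c).
  have satT : edge_saturated [set: G] by [].
  case: c; first exact: edge_saturated_splitr satT (esym TE) sE.
  exact: edge_saturated_splitl satT (esym TE) sE.
have vE c : exists v, E c (gl_pt v).
  have [[v|[x e]] Ex] := E0 c; first by exists v.
  exists (gl_src e); apply: satE Ex _ _ (gl_iota_src e).
  by exists x.
have [[a Ea] [b Eb]] := (vE false, vE true).
have [H [a' [b' [aa' bb' [_ conP _]]]]] := paG a b.
have conH : connected (range (@sub_incl R G H)).
  apply: (@connected_continuous_connected (initial_topology (@sub_incl R G H))) => //.
  exact/continuous_subspaceT/initial_continuous.
have HE : range (@sub_incl R G H) `<=` E false `|` E true by rewrite -TE.
have Ha : range (@sub_incl R G H) (gl_pt a) by exists (inl a') => //=; rewrite aa'.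
have Hb : range (@sub_incl R G H) (gl_pt b) by exists (inl b') => //=; rewrite bb'.
have [HE'|HE'] := connected_subset sE HE conH.
  have : (E false `&` E true) (gl_pt b) by split=> //; exact: HE'.
  by rewrite (separated_disjoint sE).
have : (E false `&` E true) (gl_pt a) by split=> //; exact: HE'.
by rewrite (separated_disjoint sE).
Qed.

Theorem theorem4p6 (R : realType) (G : graphLike R)
  (cptG : compact [set: G]) :
  connected [set: G] <-> pseudo_arc_connected G.
Proof.
split; first exact: connected_pseudo_arc_connected.
exact: pseudo_arc_connected_connected.
Qed.
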